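(* Let $(X,\mathcal{B})$ be a premeasurable space and let $F_{\mathcal{B}},G:\mathbf{Part}_c^f\to\mathbf{Pos}$ and $\Sigma$ be as described in the context. For an order-preserving map $\mu:\mathcal{B}\to[0,\infty]$ with $\mu(\emptyset)=0$ and a countable set $A$, define $\tau^\mu_A:F_{\mathcal{B}}A\to GA$ by $\tau^\mu_A((E_a)_{a\in A})=(\mu(E_a))_{a\in A}$. Then the assignment $\mu\mapsto\tau^\mu$ defines isomorphisms of posets $$M_{\le}(X,\mathcal{B})\to[F_{\mathcal{B}},G]^\Sigma_l,\qquad M(X,\mathcal{B})\to[F_{\mathcal{B}},G]_s,\qquad M_{\ge}(X,\mathcal{B})\to[F_{\mathcal{B}},G]^\Sigma_c .$$
   Context: A premeasurable space is a set $X$ with an algebra $\mathcal{B}$ of subsets (closed under finite unions and complements). An order-preserving map $\mu:\mathcal{B}\to[0,\infty]$ with $\mu(\emptyset)=0$ is an outer premeasure (resp. inner premeasure) if $\mu(B)\le\sum_{n=1}^\infty\mu(B_n)$ (resp. $\mu(B)\ge\sum_{n=1}^\infty\mu(B_n)$) whenever $(B_n)_{n\ge1}$ are pairwise disjoint elements of $\mathcal{B}$ with $B:=\bigcup_nB_n\in\mathcal{B}$. A premeasure is a map $\mu:\mathcal{B}\to[0,\infty]$ with $\mu(\emptyset)=0$ for which equality always holds. $M_\le(X,\mathcal{B})$, $M_\ge(X,\mathcal{B})$, $M(X,\mathcal{B})$ are the sets of outer premeasures, inner premeasures and premeasures, with pointwise order. $\mathbf{Pos}$ is the category of posets and order-preserving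 maps, enriched over itself. For a countable (possibly finite) set $A$, $\mathcal{P}_f(A)$ is the algebra of finite and cofinite subsets. A partial map $f:A\to B$ of countable sets is finite if $f^{-1}(B')\in\mathcal{P}_f(A)$ for all $B'\in\mathcal{P}_f(B)$. $\mathbf{Part}_c^f$ is the poset-enriched category of countable sets and finite partial maps, where $f_1\le f_2$ iff $\mathrm{dom} f_1\subseteq\mathrm{dom} f_2$ and they agree on $\mathrm{dom} f_1$. $\Sigma$ is the collection of injective finite partial maps. $F_{\mathcal{B}}A$ is the poset of families $(E_a)_{a\in A}$ of pairwise disjoint elements of $\mathcal{B}$ with $\bigcup_aE_a\in\mathcal{B}$, ordered by componentwise inclusion, and $F_{\mathcal{B}}f((E_a)_a)=\left(\bigcup_{f(a)=b}E_a\right)_{b}$. $GA=[0,\infty]^A$ with pointwise order, and $Gf((p_a)_a)=\left(\sum_{f(a)=b}p_a\right)_{b}$. For enriched functors $F,G$, a $\Sigma$-natural lax (resp. colax) transformation $\tau:F\to G$ is a family of order-preserving maps $\tau_A:FA\to GA$ with $\tau_B\circ Ff\le Gf\circ\tau_A$ (resp. $\ge$) for all morphisms $f:A\to B$, with equality when $f\in\Sigma$. It is strict if equality holds for all $f$. $[F,G]^\Sigma_l$, $[F,G]^\Sigma_c$, $[F,G]_s$ are the posets of $\Sigma$-natural lax, $\Sigma$-natural colax, and strict transformations with the pointwise order. *)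

(* Defs.v *)
From HB Require Import structures.
From mathcomp Require Import all_boot all_order all_algebra.
From mathcomp Require Import interval_inference.
From mathcomp Require Import all_classical all_reals.
From mathcomp Require Import topology ereal normedtype sequences esum.
From mathcomp Require Import measurable_structure.

Set Implicit Arguments.
Unset Strict Implicit.
Unset Printing Implicit Defensive.

Import Order.TTheory GRing.Theory Num.Theory.

Local Open Scope order_scope.
Local Open Scope classical_set_scope.

HB.instance Definition _ d (T : porderType d) (P : pred T) :
  Order.POrder d {x : T | P x} := [POrder of {x : T | P x} by <:].

Definition poset_iso d d' (T : porderType d) (T' : porderType d')
    (f : T -> T') : Prop :=
  bijective f /\ {mono f : x y / x <= y}.

(* Categories enriched over posets, and enriched functors to the
   category of posets and order-preserving maps. *)
Record pos_category := PosCategory {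
  object :> Type;
  mor_display : Order.disp_t;
  mor : object -> object -> porderType mor_display;
  mor_id : forall A, mor A A;
  mor_comp : forall A B C, mor B C -> mor A B -> mor A C;
  mor_compA : forall A B C D (h : mor C D) (g : mor B C) (f : mor A B),
    mor_comp h (mor_comp g f) = mor_comp (mor_comp h g) f;
  mor_comp1f : forall A B (f : mor A B), mor_comp (mor_id B) f = f;
  mor_compf1 : forall A B (f : mor A B), mor_comp f (mor_id A) = f;
  le_mor_comp : forall A B C (g g' : mor B C) (f f' : mor A B),
    g <= g' -> f <= f' -> mor_comp g f <= mor_comp g' f' }.

Record pos_functor (C : pos_category) (d : Order.disp_t) := PosFunctor {
  functor_obj :> C -> porderType d;
  functor_map : forall A B,
    mor A B -> {omorphism functor_obj A -> functor_obj B};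
  functor_map_id : forall A (x : functor_obj A), functor_map (mor_id A) x = x;
  functor_map_comp : forall A B D (g : mor B D) (f : mor A B)
      (x : functor_obj A),
    functor_map (mor_comp g f) x = functor_map g (functor_map f x);
  le_functor_map : forall A B (f g : mor A B), f <= g ->
    forall x : functor_obj A, functor_map f x <= functor_map g x }.

Definition transf (C : pos_category) d d'
    (F : pos_functor C d) (G : pos_functor C d') : Type :=
  forall A : C, {omorphism F A -> G A}.

Section transformations.
Context (C : pos_category) (d d' : Order.disp_t).
Context (F : pos_functor C d) (G : pos_functor C d').
Implicit Types s t : transf F G.

Lemma transf_ext s t : (forall A x, s A x = t A x) -> s = t.
Proof.
move=> st; apply: functional_extensionality_dep => A.
have := st A; case: (s A) => f [[f_le]]; case: (t A) => g [[g_le]] /= fg.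
have fgE : f = g by exact/funext.
by rewrite fgE in f_le *; rewrite (Prop_irrelevance f_le g_le).
Qed.

HB.instance Definition _ := gen_eqMixin (transf F G).
HB.instance Definition _ := gen_choiceMixin (transf F G).

Definition transf_le s t : bool := `[< forall A x, s A x <= t A x >].

Let transf_lt s t : bool := (t != s) && transf_le s t.

Let transf_lt_def s t : transf_lt s t = (t != s) && transf_le s t.
Proof. by []. Qed.

Let transf_le_refl : reflexive transf_le.
Proof. by move=> s; apply/asboolP => A x. Qed.

Let transf_le_anti : antisymmetric transf_le.
Proof.
move=> s t /andP[/asboolP st /asboolP ts]; apply: transf_ext => A x.
by apply/eqP; rewrite eq_le st ts.
Qed.

Let transf_le_trans : transitive transf_le.
Proof.
move=> t s u /asboolP st /asboolP tu; apply/asboolP => A x.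
exact: le_trans (st A x) (tu A x).
Qed.

HB.instance Definition _ := Order.isPOrder.Build Order.default_display
  (transf F G) transf_lt_def transf_le_refl transf_le_anti transf_le_trans.

Context (Sigma : forall A B : C, set (mor A B)).

Definition lax_transf : set (transf F G) := [set t : transf F G |
  forall (A B : C) (f : mor A B),
    (forall x, t B (functor_map F f x) <= functor_map G f (t A x)) /\
    (Sigma f -> forall x, t B (functor_map F f x) = functor_map G f (t A x))].

Definition colax_transf : set (transf F G) := [set t : transf F G |
  forall (A B : C) (f : mor A B),
    (forall x, functor_map G f (t A x) <= t B (functor_map F f x)) /\
    (Sigma f -> forall x, t B (functor_map F f x) = functor_map G f (t A x))].

Definition strict_transf : set (transf F G) := [set t : transf F G |
  forall (A B : C) (f : mor A B) x,
    t B (functor_map F f x) = functor_map G f (t A x)].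

End transformations.
Arguments lax_transf {C d d'} F G Sigma.
Arguments colax_transf {C d d'} F G Sigma.
Arguments strict_transf {C d d'} F G.

Definition finite_cofinite (A : Type) : set (set A) :=
  [set S | finite_set S \/ cofinite_set S].

(* f a = None when f is undefined at a. *)
Definition partial_map (A B : Type) : Type := A -> option B.

Definition pdom A B (f : partial_map A B) : set A := [set a | f a].

Definition ppreimage A B (f : partial_map A B) (S : set B) : set A :=
  f @^-1` (Some @` S).

Section partial_map_order.
Context (A B : Type).
Implicit Types f g : partial_map A B.

HB.instance Definition _ := gen_eqMixin (partial_map A B).
HB.instance Definition _ := gen_choiceMixin (partial_map A B).

Definition partial_map_le f g : bool :=
  `[< pdom f `<=` pdom g /\ {in pdom f, f =1 g} >].

Let partial_map_lt f g : bool := (g != f) && partial_map_le f g.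

Let partial_map_lt_def f g :
  partial_map_lt f g = (g != f) && partial_map_le f g.
Proof. by []. Qed.

Lemma partial_map_leP f g :
  reflect (forall a b, f a = Some b -> g a = Some b) (partial_map_le f g).
Proof.
apply: (iffP (asboolP _)) => [[_ fg] a b fab|fg].
  by rewrite -fg// inE /pdom /= fab.
split=> a.
  by rewrite /pdom /=; case fa: (f a) => [b|//] _; rewrite (fg _ _ fa).
by rewrite inE /pdom /=; case fa: (f a) => [b|//] _; rewrite (fg _ _ fa).
Qed.

Let partial_map_le_refl : reflexive partial_map_le.
Proof. by move=> f; apply/partial_map_leP. Qed.

Let partial_map_le_anti : antisymmetric partial_map_le.
Proof.
move=> f g /andP[/partial_map_leP fg /partial_map_leP gf].
apply/funext => a; case fa: (f a) => [b|]; first by rewrite (fg _ _ fa).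
by case ga: (g a) => [b|//]; rewrite (gf _ _ ga) in fa.
Qed.

Let partial_map_le_trans : transitive partial_map_le.
Proof.
move=> g f h /partial_map_leP fg /partial_map_leP gh.
by apply/partial_map_leP => a b /fg /gh.
Qed.

HB.instance Definition _ := Order.isPOrder.Build Order.default_display
  (partial_map A B) partial_map_lt_def
  partial_map_le_refl partial_map_le_anti partial_map_le_trans.

Definition finite_pmap : set (partial_map A B) := [set f : partial_map A B |
  forall S, finite_cofinite S -> finite_cofinite (ppreimage f S)].

End partial_map_order.
Arguments finite_pmap : clear implicits.

(* The carriers range over one fixed universe, so the objects form a type on
   which transformations can be collected into a poset. *)
Record countable_set := CountableSet {
  carrier :> Type;
  carrier_countable : countable [set: carrier] }.

(* esum indexes over a choiceType. *)
HB.instance Definition _ (A : countable_set) := gen_eqMixin (carrier A).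
HB.instance Definition _ (A : countable_set) := gen_choiceMixin (carrier A).

Section partc_category.
Implicit Types A B C D : countable_set.

Lemma ppreimage_id A (S : set A) : ppreimage (@Some A) S = S.
Proof.
by apply/seteqP; split=> [a [b Sb [<-]]|a Sa] //; exists a.
Qed.

Lemma finite_pmap_id A : @Some A \in finite_pmap A A.
Proof. by apply/mem_set => S; rewrite ppreimage_id. Qed.

Definition fpm_id A : finite_pmap A A := SigSub (finite_pmap_id A).

Lemma ppreimage_comp A B C (g : partial_map B C) (f : partial_map A B) S :
  ppreimage (fun a => obind g (f a)) S = ppreimage f (ppreimage g S).
Proof.
apply/seteqP; split=> a; rewrite /ppreimage /=.
  by case: (f a) => [b|] [c Sc] //= gb; exists b => //; exists c.
by move=> [b [c Sc gb] <-]; exists c.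
Qed.

Lemma finite_pmap_comp A B C (g : finite_pmap B C) (f : finite_pmap A B) :
  (fun a => obind (\val g) (\val f a)) \in finite_pmap A C.
Proof.
apply/mem_set => S S_fin; rewrite ppreimage_comp.
by apply: (set_mem (valP f)); apply: (set_mem (valP g)).
Qed.

Definition fpm_comp A B C (g : finite_pmap B C) (f : finite_pmap A B) :
  finite_pmap A C := SigSub (finite_pmap_comp g f).

Lemma fpm_compA A B C D (h : finite_pmap C D) (g : finite_pmap B C)
  (f : finite_pmap A B) : fpm_comp h (fpm_comp g f) = fpm_comp (fpm_comp h g) f.
Proof. by apply/val_inj/funext => a /=; case: (\val f a). Qed.

Lemma fpm_comp1f A B (f : finite_pmap A B) : fpm_comp (fpm_id B) f = f.
Proof. by apply/val_inj/funext => a /=; case: (\val f a). Qed.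

Lemma fpm_compf1 A B (f : finite_pmap A B) : fpm_comp f (fpm_id A) = f.
Proof. exact/val_inj/funext. Qed.

Lemma le_fpm_comp A B C (g g' : finite_pmap B C) (f f' : finite_pmap A B) :
  g <= g' -> f <= f' -> fpm_comp g f <= fpm_comp g' f'.
Proof.
move=> /partial_map_leP gg' /partial_map_leP ff'; apply/partial_map_leP.
move=> a c /=; case fa: (\val f a) => [b|//] /= gb.
by rewrite (ff' _ _ fa) /= (gg' _ _ gb).
Qed.

Definition Partcf : pos_category :=
  @PosCategory countable_set _ (fun A B => finite_pmap A B) fpm_id fpm_comp
    fpm_compA fpm_comp1f fpm_compf1 le_fpm_comp.

Definition Sigma (A B : Partcf) : set (mor A B) :=
  [set f | set_inj (pdom (\val f)) (\val f)].

End partc_category.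

Record set_algebra (X : Type) := SetAlgebra {
  members :> set (set X);
  alg_set0 : members set0;
  alg_setU : setU_closed members;
  alg_setC : setC_closed members }.

Definition empty_member X (B : set_algebra X) : B :=
  SigSub (mem_set (alg_set0 B)).

Definition disjoint_families X (B : set_algebra X) (A : Type) : set (A -> B) :=
  [set E | trivIset setT (fun a => \val (E a)) /\
           members B (\bigcup_a \val (E a))].
Arguments disjoint_families {X} B A.

Section functor_F.
Context (X : Type) (B : set_algebra X).
Local Notation FB := (disjoint_families B).
Implicit Types A C D : countable_set.

Lemma alg_setD (S T : set X) :
  members B S -> members B T -> members B (S `\` T).
Proof.
move=> BS BT; rewrite setDE -[S]setCK -setCU; apply: alg_setC.
by apply: alg_setU => //; apply: alg_setC.
Qed.

Lemma alg_bigcup_finite (I : Type) (S : set I) (E : I -> set X) :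
  finite_set S -> (forall i, members B (E i)) ->
  members B (\bigcup_(i in S) E i).
Proof.
elim/Pchoice: I => I in S E *.
move=> S_fin BE; rewrite -bigsetU_fset_set//.
by apply: (big_ind (members B)) => //; [exact: alg_set0|exact: alg_setU].
Qed.

Lemma disjoint_family_bigcup A (E : FB A) (S : set A) :
  finite_cofinite S -> members B (\bigcup_(a in S) \val (\val E a)).
Proof.
have BE a : members B (\val (\val E a)) by exact: (set_mem (valP (\val E a))).
have [E_triv BU] := set_mem (valP E).
case=> S_fin; first exact: alg_bigcup_finite.
have -> : \bigcup_(a in S) \val (\val E a) =
    (\bigcup_a \val (\val E a)) `\` \bigcup_(a in ~` S) \val (\val E a).
  apply/seteqP; split=> x.
    move=> [a Sa Eax]; split; first by exists a.
    move=> [a' Sa' Ea'x]; apply: Sa'.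
    by rewrite -(E_triv a a')//; exists x.
  move=> [[a _ Eax] NSx]; exists a => //.
  by apply: contrapT => Sa; apply: NSx; exists a.
by apply: alg_setD => //; exact: alg_bigcup_finite.
Qed.

Definition fiber A C (f : partial_map A C) (c : C) : set A :=
  [set a | f a = Some c].

Lemma fiberE A C (f : partial_map A C) c : fiber f c = ppreimage f [set c].
Proof. by rewrite /ppreimage image_set1. Qed.

Lemma fiber_finite_cofinite A C (f : finite_pmap A C) c :
  finite_cofinite (fiber (\val f) c).
Proof.
by rewrite fiberE; apply: (set_mem (valP f)); left; exact: finite_set1.
Qed.

Definition F_member A C (f : finite_pmap A C) (E : FB A) (c : C) : B :=
  SigSub (mem_set (disjoint_family_bigcup E (fiber_finite_cofinite f c))).

Lemma F_map_subproof A C (f : finite_pmap A C) (E : FB A) :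
  F_member f E \in FB C.
Proof.
have [E_triv _] := set_mem (valP E).
apply/mem_set; split.
  move=> c c' _ _ [x [[a fa Eax] [a' fa' Ea'x]]].
  have aa' : a = a' by apply: E_triv => //; exists x.
  by move: fa fa'; rewrite aa' /fiber /= => -> [].
have -> : \bigcup_c \val (F_member f E c) =
    \bigcup_(a in ppreimage (\val f) setT) \val (\val E a).
  apply/seteqP; split=> x.
    by move=> [c _ [a fa Eax]]; exists a => //; exists c.
  by move=> [a [c _ fa] Eax]; exists c => //; exists a.
apply: disjoint_family_bigcup; apply: (set_mem (valP f)).
by right; rewrite setCT; exact: finite_set0.
Qed.

Definition F_map A C (f : finite_pmap A C) (E : FB A) : FB C :=
  SigSub (F_map_subproof f E).

Lemma le_F_map A C (f g : finite_pmap A C) (E E' : FB A) :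
  f <= g -> E <= E' -> F_map f E <= F_map g E'.
Proof.
move=> /partial_map_leP fg /lefP EE'; apply/lefP => c.
apply/subsetPset => x [a fa Eax]; exists a; first exact: fg.
by move/subsetPset: (EE' a); apply.
Qed.

Lemma F_map_le A C (f : finite_pmap A C) : {homo F_map f : E E' / E <= E'}.
Proof. by move=> E E'; exact: le_F_map. Qed.

HB.instance Definition _ A C (f : finite_pmap A C) :=
  Order.isOrderMorphism.Build _ _ _ _ (F_map f) (@F_map_le A C f).

Lemma F_map_id A (E : FB A) : F_map (fpm_id A) E = E.
Proof.
apply/val_inj/funext => a; apply/val_inj; rewrite /=.
by apply/seteqP; split=> [x [a' [->]]//|x Eax]; exists a.
Qed.

Lemma F_map_comp A C D (g : finite_pmap C D) (f : finite_pmap A C) (E : FB A) :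
  F_map (fpm_comp g f) E = F_map g (F_map f E).
Proof.
apply/val_inj/funext => d; apply/val_inj; rewrite /=.
apply/seteqP; split=> x.
  move=> [a]; rewrite /fiber /=; case fa: (\val f a) => [c|//] /= gc Eax.
  by exists c => //; exists a.
by move=> [c gc [a fa Eax]]; exists a => //; rewrite /fiber /= fa.
Qed.

Definition F_B : pos_functor Partcf _ :=
  @PosFunctor Partcf _ (fun A : countable_set => FB A) (fun A C f => F_map f)
    F_map_id F_map_comp (fun A C f g fg E => le_F_map fg (lexx E)).

End functor_F.

Local Open Scope ring_scope.
Local Open Scope ereal_scope.

Section functor_G.
Context (R : realType).
Local Notation GR A := (A -> {nonneg \bar R}).
Implicit Types A C D : countable_set.

Lemma G_sum_ge0 A (p : GR A) (S : set A) :
  Itv.spec (@ext_num_sem R) (Itv.Real `[0%Z, +oo[)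
    (\esum_(a in S) (p a)%:num).
Proof.
have sum_ge0 : 0 <= \esum_(a in S) (p a)%:num by apply: esum_ge0 => a _.
by rewrite /= /ext_num_sem /= in_itv /= sum_ge0 /Order.comparable sum_ge0.
Qed.

Definition G_map A C (f : finite_pmap A C) (p : GR A) : GR C :=
  fun c => Itv.mk (G_sum_ge0 p (fiber (\val f) c)).

Lemma le_G_map A C (f g : finite_pmap A C) (p q : GR A) :
  (f <= g)%O -> (p <= q)%O -> (G_map f p <= G_map g q)%O.
Proof.
move=> /partial_map_leP fg /lefP pq; apply/lefP => c.
rewrite -[_ _ _]/((\esum_(a in fiber (\val f) c) (p a)%:num <=
  \esum_(a in fiber (\val g) c) (q a)%:num)%E).
apply: (@le_trans _ _ (\esum_(a in fiber (\val f) c) (q a)%:num)).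
  by apply: le_esum => a _; exact: pq.
rewrite [leRHS]esum_mkcond [leLHS]esum_mkcond; apply: le_esum => a _.
case: ifPn => [/set_mem fa|_]; last by case: ifPn.
by rewrite mem_set//; exact: fg.
Qed.

Lemma G_map_le A C (f : finite_pmap A C) :
  {homo G_map f : p q / (p <= q)%O}.
Proof. by move=> p q; exact: le_G_map. Qed.

HB.instance Definition _ A C (f : finite_pmap A C) :=
  Order.isOrderMorphism.Build _ _ _ _ (G_map f) (@G_map_le A C f).

Lemma G_map_id A (p : GR A) : G_map (fpm_id A) p = p.
Proof.
apply/funext => a; apply/val_inj => /=.
rewrite (_ : fiber _ a = [set a]) ?esum_set1//.
by apply/seteqP; split=> [a' [->]|a' ->].
Qed.

Lemma G_map_comp A C D (g : finite_pmap C D) (f : finite_pmap A C) (p : GR A) :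
  G_map (fpm_comp g f) p = G_map g (G_map f p).
Proof.
apply/funext => d; apply/val_inj => /=.
rewrite esum_esum//=.
apply: (@reindex_esum _ _ _ _ _ snd (fun a => (p a)%:num)); split.
- by move=> [c a] [/= gc fa]; rewrite /fiber /= fa.
- move=> [c a] [c' a'] /set_mem[/= _ fa] /set_mem[/= _ fa'] aa'.
  by move: fa fa'; rewrite /fiber /= aa' => -> [->].
- move=> a; rewrite /fiber /=; case fa: (\val f a) => [c|//] /= gc.
  by exists (c, a).
Qed.

Definition G_R : pos_functor Partcf _ :=
  @PosFunctor Partcf _ (fun A : countable_set => A -> {nonneg \bar R})
    (fun A C f => G_map f) G_map_id G_map_comp
    (fun A C f g fg p => le_G_map fg (lexx p)).

End functor_G.

Section premeasures.
Context (R : realType) (X : Type) (B : set_algebra X).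
Implicit Types mu : B -> {nonneg \bar R}.

Definition outer_premeasure : set (B -> {nonneg \bar R}) := [set mu |
  [/\ {homo mu : E E' / (E <= E')%O},
      (mu (empty_member B))%:num = 0 &
      forall (E : B) (En : nat -> B),
        trivIset setT (fun n => \val (En n)) ->
        \val E = \bigcup_n \val (En n) ->
        (mu E)%:num <= \sum_(0 <= n <oo) (mu (En n))%:num]].

Definition inner_premeasure : set (B -> {nonneg \bar R}) := [set mu |
  [/\ {homo mu : E E' / (E <= E')%O},
      (mu (empty_member B))%:num = 0 &
      forall (E : B) (En : nat -> B),
        trivIset setT (fun n => \val (En n)) ->
        \val E = \bigcup_n \val (En n) ->
        \sum_(0 <= n <oo) (mu (En n))%:num <= (mu E)%:num]].

Definition premeasure : set (B -> {nonneg \bar R}) := [set mu |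
  (mu (empty_member B))%:num = 0 /\
  forall (E : B) (En : nat -> B),
    trivIset setT (fun n => \val (En n)) ->
    \val E = \bigcup_n \val (En n) ->
    (mu E)%:num = \sum_(0 <= n <oo) (mu (En n))%:num].

Definition tau mu (A : Partcf) : F_B B A -> G_R R A :=
  fun E a => mu (\val E a).

End premeasures.
Arguments outer_premeasure R {X} B.
Arguments inner_premeasure R {X} B.
Arguments premeasure R {X} B.

(* Main.v *)
(* A Sigma-natural transformation t is determined by the set function
   mu E := t_1 E on one-point families: the partial map defined only at a is
   injective, so naturality along it gives (t_A E)_a = mu (E_a), and the nowhere
   defined map gives mu set0 = 0. Under t = tau mu, the (co)lax inequality along
   the total map nat -> 1 is countable sub(super)additivity of mu; conversely,
   each component of the inequality along f is an instance of it, since the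
   fibers of f are countable. Strict transformations are the lax and colax ones,
   and premeasures the outer and inner ones. *)

Require Import Defs.
From HB Require Import structures.
From mathcomp Require Import all_boot all_order all_algebra.
From mathcomp Require Import all_classical all_reals.
From mathcomp Require Import topology ereal normedtype sequences esum.
From mathcomp Require Import measurable_structure.
From mathcomp Require Import interval_inference.

Set Implicit Arguments.
Unset Strict Implicit.
Unset Printing Implicit Defensive.

Import Order.TTheory GRing.Theory Num.Theory.

Local Open Scope classical_set_scope.
Local Open Scope ring_scope.
Local Open Scope ereal_scope.

(** * Test objects and test morphisms of [Partcf] *)

Definition unit_cset : Partcf := @CountableSet unit (countableP _).
Definition nat_cset : Partcf := @CountableSet nat (countableP _).

Section partial_maps.
Implicit Types A C : countable_set.

Lemma finite_pmap_empty A C : (fun _ : A => None) \in finite_pmap A C.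
Proof.
apply/mem_set => S _; left; rewrite (_ : ppreimage _ _ = set0)//.
by apply/seteqP; split=> // a [].
Qed.

Definition pmap_empty A C : finite_pmap A C := SigSub (finite_pmap_empty A C).

Lemma finite_pmap_point A (a : A) :
  (fun a' => if a' == a then Some tt else None) \in finite_pmap A unit_cset.
Proof.
apply/mem_set => S _; left; apply: (@sub_finite_set _ _ [set a]).
  by move=> a' [u _] /=; case: eqP.
exact: finite_set1.
Qed.

Definition pmap_point A (a : A) : finite_pmap A unit_cset :=
  SigSub (finite_pmap_point a).

Lemma fiber_point A (a : A) : fiber (\val (pmap_point a)) tt = [set a].
Proof.
by apply/seteqP; split=> a'; rewrite /fiber /=; case: eqP.
Qed.

(** Each preimage is empty or all of [A], and the latter is cofinite even when [A] is infinite. Thus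
    an infinite [A] may be collapsed to a point inside [Partcf]. *)
Lemma finite_pmap_total A : (fun _ : A => Some tt) \in finite_pmap A unit_cset.
Proof.
apply/mem_set => S _; have [Stt|NStt] := pselect (S tt).
  right; rewrite (_ : ppreimage _ _ = setT) ?setCT; first exact: finite_set0.
  by apply/seteqP; split=> // a _; exists tt.
left; rewrite (_ : ppreimage _ _ = set0); first exact: finite_set0.
by apply/seteqP; split=> // a [[]].
Qed.

Definition pmap_total A : finite_pmap A unit_cset :=
  SigSub (finite_pmap_total A).

Lemma fiber_total A : fiber (\val (pmap_total A)) tt = setT.
Proof. by apply/seteqP; split. Qed.

Lemma Sigma_empty (A C : Partcf) : @Sigma A C (pmap_empty A C).
Proof. by move=> a a' /set_mem. Qed.

Lemma Sigma_point (A : Partcf) (a : A) : @Sigma A unit_cset (pmap_point a).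
Proof.
move=> a1 a2 /set_mem; rewrite /pdom /=; case: eqP => // -> _ /set_mem.
by rewrite /pdom /=; case: eqP.
Qed.

(** Along [Sigma], unions and sums over a fiber thus have at most one term. *)
Lemma Sigma_fiber (A C : Partcf) (f : mor A C) c : Sigma f ->
  fiber (\val f) c = set0 \/ exists a, fiber (\val f) c = [set a].
Proof.
move=> f_inj; have [|/set0P[a fa]] := eqVneq (fiber (\val f) c) set0.
  by left.
right; exists a; apply/seteqP; split=> [a' fa'|_ ->] //=.
apply: f_inj; rewrite ?inE /pdom /=.
- by rewrite fa'.
- by rewrite fa.
- by rewrite fa fa'.
Qed.

End partial_maps.

Lemma nonneg_leE (R : realType) (x y : {nonneg \bar R}) :
  (x <= y)%O = (x%:num <= y%:num).
Proof. by []. Qed.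

(** * Set functions and [Sigma]-natural transformations *)

Section transformations_of_set_functions.
Context (R : realType) (X : Type) (B : set_algebra X).
Implicit Types (mu : B -> {nonneg \bar R}) (A C : Partcf).
Implicit Types t : transf (F_B B) (G_R R).

Lemma single_family_subproof (E : B) :
  (fun _ : unit => E) \in disjoint_families B unit.
Proof.
apply/mem_set; split; first by move=> [] [].
rewrite (_ : \bigcup_a _ = \val E); first exact: (set_mem (valP E)).
by apply/seteqP; split=> [x [_ _]|x Ex] //; exists tt.
Qed.

Definition single_family (E : B) : F_B B unit_cset :=
  SigSub (single_family_subproof E).

Lemma single_family_le : {homo single_family : E E' / (E <= E')%O}.
Proof. by move=> E E' EE'; apply/lefP => -[]. Qed.

(** Identifies the value of [F_B B] at the point with [B], which reduces equalities of families
    there to equalities of sets. *)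
Lemma F_B_unit (E : F_B B unit_cset) : E = single_family (\val E tt).
Proof. by apply/val_inj/funext => -[]. Qed.

Lemma tau_le mu A : {homo mu : E E' / (E <= E')%O} ->
  {homo @tau R X B mu A : E E' / (E <= E')%O}.
Proof. by move=> mu_le E E' /lefP EE'; apply/lefP => a; apply: mu_le. Qed.

Definition tau_omorphism mu (mu_le : {homo mu : E E' / (E <= E')%O}) A :
  {omorphism F_B B A -> G_R R A} :=
  HB.pack (@tau R X B mu A)
    (Order.isOrderMorphism.Build _ _ _ _ (@tau R X B mu A) (tau_le mu_le)).

Definition tau_transf mu (mu_le : {homo mu : E E' / (E <= E')%O}) :
  transf (F_B B) (G_R R) := tau_omorphism mu_le.

Definition set_function_of (t : transf (F_B B) (G_R R)) :
  B -> {nonneg \bar R} := fun E => t unit_cset (single_family E) tt.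

Lemma set_function_of_le t : {homo set_function_of t : E E' / (E <= E')%O}.
Proof.
move=> E E' EE'; have /lefP := omorph_le (t unit_cset) (single_family_le EE').
exact.
Qed.

Lemma set_function_of_tau mu (t : transf (F_B B) (G_R R)) :
  (forall A E, t A E = tau mu E) -> set_function_of t = mu.
Proof. by move=> tE; apply/funext => E; rewrite /set_function_of tE. Qed.

(** The condition common to lax, colax and strict transformations; it suffices to reconstruct [t]
    from its component at the point. *)
Definition Sigma_natural (t : transf (F_B B) (G_R R)) :=
  forall A C (f : mor A C), Sigma f ->
    forall x, t C (functor_map (F_B B) f x) = functor_map (G_R R) f (t A x).

Lemma Sigma_natural_tau t : Sigma_natural t ->
  forall A E, t A E = tau (set_function_of t) E.
Proof.
move=> t_nat A E; apply/funext => a; apply/val_inj.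
have := t_nat _ _ _ (@Sigma_point A a) E.
move=> /(congr1 (fun p => (p tt)%:num)) /=.
rewrite fiber_point esum_set1//= => <-.
rewrite /tau /set_function_of; congr (t unit_cset _ tt)%:num.
rewrite [LHS]F_B_unit; congr single_family; apply/val_inj => /=.
by rewrite fiber_point bigcup_set1.
Qed.

Lemma Sigma_natural_set0 t : Sigma_natural t ->
  (set_function_of t (empty_member B))%:num = 0.
Proof.
move=> t_nat.
have := t_nat _ _ _ (@Sigma_empty unit_cset unit_cset)
  (single_family (empty_member B)).
have fiber0 : fiber (\val (pmap_empty unit_cset unit_cset)) tt = set0.
  by apply/seteqP; split.
move=> /(congr1 (fun p => (p tt)%:num)) /=.
rewrite fiber0 esum_set0 => <-; congr (t unit_cset _ tt)%:num.
rewrite [RHS]F_B_unit; congr single_family; apply/val_inj => /=.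
by rewrite fiber0 bigcup_set0.
Qed.

(** Over an empty fiber both sides are 0 by [mu0]; over a one-point fiber both are [mu] of the
    single member. *)
Lemma tau_Sigma_natural mu (t : transf (F_B B) (G_R R)) :
  (mu (empty_member B))%:num = 0 ->
  (forall A E, t A E = tau mu E) -> Sigma_natural t.
Proof.
move=> mu0 tE A C f f_Sigma E; rewrite !tE; apply/funext => c; apply/val_inj.
rewrite /tau /=; have [f0|[a fa]] := Sigma_fiber c f_Sigma.
  rewrite f0 esum_set0 -[RHS]mu0; congr (mu _)%:num; apply/val_inj => /=.
  by rewrite f0 bigcup_set0.
rewrite fa esum_set1//; congr (mu _)%:num; apply/val_inj => /=.
by rewrite fa bigcup_set1.
Qed.

(** * Countable decompositions as families over [nat] *)

Lemma nat_family_subproof (E : B) (En : nat -> B) :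
  trivIset setT (fun n => \val (En n)) -> \val E = \bigcup_n \val (En n) ->
  En \in disjoint_families B nat.
Proof.
move=> En_triv EU; apply/mem_set; split=> //; rewrite -EU.
exact: set_mem (valP E).
Qed.

Definition nat_family (E : B) (En : nat -> B)
    (En_triv : trivIset setT (fun n => \val (En n)))
    (EU : \val E = \bigcup_n \val (En n)) : F_B B nat_cset :=
  SigSub (nat_family_subproof En_triv EU).

Lemma F_total (E : B) (En : nat -> B)
    (En_triv : trivIset setT (fun n => \val (En n)))
    (EU : \val E = \bigcup_n \val (En n)) :
  functor_map (F_B B) (pmap_total nat_cset) (nat_family En_triv EU) =
  single_family E.
Proof.
rewrite [LHS]F_B_unit; congr single_family; apply/val_inj => /=.
by rewrite fiber_total EU.
Qed.

Lemma G_total (p : G_R R nat_cset) :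
  (functor_map (G_R R) (pmap_total nat_cset) p tt)%:num =
  \sum_(0 <= n <oo) (p n)%:num.
Proof.
rewrite /= fiber_total nneseries_esumT//.
(* [nat_cset] carries the generic classical choice structure rather than the usual one of [nat];
   reindexing along the identity passes between the two sums. *)
apply: (@reindex_esum R nat nat_cset setT setT id (fun n => (p n)%:num)).
by split=> // n _; exists n.
Qed.

(* Padding with empty sets along an injection of A into nat turns a family
   indexed by a subset of A into a sequence. *)
Lemma family_sequence mu A (E : F_B B A) (S : set A) :
  (mu (empty_member B))%:num = 0 ->
  exists En : nat -> B, [/\ trivIset setT (fun n => \val (En n)),
    \bigcup_n \val (En n) = \bigcup_(a in S) \val (\val E a) &
    \sum_(0 <= n <oo) (mu (En n))%:num = \esum_(a in S) (mu (\val E a))%:num].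
Proof.
move=> mu0; have [E_triv _] := set_mem (valP E).
have /countable_injP[g g_inj] := carrier_countable A.
have gI : injective g by move=> a a'; apply: g_inj; rewrite inE.
pose En n := if pselect (exists2 a, S a & g a = n) is left ex
  then \val E (projT1 (cid2 ex)) else empty_member B.
have Eng a : S a -> En (g a) = \val E a.
  rewrite /En => Sa; case: pselect => [ex|[]]; last by exists a.
  by case: cid2 => a' /= Sa' gaa'; congr (\val E _); apply: gI.
have En0 n : ~ (g @` S) n -> En n = empty_member B.
  by rewrite /En => NSn; case: pselect => // ex; case: NSn.
have EnP n x : \val (En n) x -> exists2 a, S a & g a = n /\ \val (\val E a) x.
  have [[a Sa <-]|/En0 ->//] := pselect ((g @` S) n).
  by rewrite Eng// => Eax; exists a.
exists En; split.
- move=> n m _ _ [x [/EnP[a Sa [<- Eax]] /EnP[a' Sa' [<- Ea'x]]]].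
  by congr g; apply: E_triv => //; exists x.
- apply/seteqP; split=> x.
    by move=> [n _ /EnP[a Sa [_ Eax]]]; exists a.
  by move=> [a Sa Eax]; exists (g a) => //; rewrite Eng.
rewrite nneseries_esumT//.
(* Terms off the image of [S] vanish by [mu0]; injectivity of [g] then carries the sum back to
   [S]. *)
transitivity (\esum_(n in g @` S) (mu (En n))%:num).
  rewrite [RHS]esum_mkcond; apply: eq_esum => n _.
  by case: ifPn => // /negP; rewrite inE => /En0 ->.
rewrite esum_image => [|a a' _ _]; last exact: gI.
by apply: eq_esum => a Sa; rewrite Eng.
Qed.

(** The union in [F_B] and the sum in [G_R] run over the same fiber, so one padded sequence computes
    both. Its union is a member of [B], which lets countable sub- or superadditivity apply. *)
Lemma fiber_sequence mu A C (f : mor A C) (E : F_B B A) (c : C) :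
  (mu (empty_member B))%:num = 0 ->
  exists En : nat -> B, [/\ trivIset setT (fun n => \val (En n)),
    \val (\val (functor_map (F_B B) f E) c) = \bigcup_n \val (En n) &
    (functor_map (G_R R) f (tau mu E) c)%:num =
      \sum_(0 <= n <oo) (mu (En n))%:num].
Proof.
move=> mu0; have [En [En_triv EnU Ensum]] :=
  family_sequence E (fiber (\val f) c) mu0.
by exists En.
Qed.

(** * Matching kinds of transformations with kinds of premeasures *)

(** Stated for any [t] with components [tau mu], so that monotonicity of [mu] is a conclusion: [mu]
    is [set_function_of t], and the components of [t] preserve order. *)
Lemma lax_tauP mu (t : transf (F_B B) (G_R R)) :
  (forall A E, t A E = tau mu E) ->
  lax_transf (F_B B) (G_R R) Sigma t <-> outer_premeasure R B mu.
Proof.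
move=> tE; have mut := set_function_of_tau tE; split=> [t_lax|[_ mu0 mu_sub]].
  have t_nat : Sigma_natural t by move=> A C f; exact: (t_lax _ _ f).2.
  rewrite -mut; split; [exact: set_function_of_le|exact: Sigma_natural_set0|].
  move=> E En En_triv EU.
  have /lefP/(_ tt) := (t_lax _ _ (pmap_total nat_cset)).1
    (nat_family En_triv EU).
  rewrite F_total nonneg_leE => le_t; apply: (le_trans le_t).
  by rewrite G_total Sigma_natural_tau.
move=> A C f; split=> [E|f_Sigma]; last exact: (tau_Sigma_natural mu0 tE).
apply/lefP => c; have [En [En_triv EU Esum]] := fiber_sequence f E c mu0.
rewrite nonneg_leE !tE; apply: le_trans (mu_sub _ _ En_triv EU) _.
by rewrite -Esum.
Qed.

Lemma colax_tauP mu (t : transf (F_B B) (G_R R)) :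
  (forall A E, t A E = tau mu E) ->
  colax_transf (F_B B) (G_R R) Sigma t <-> inner_premeasure R B mu.
Proof.
move=> tE; have mut := set_function_of_tau tE; split=> [t_lax|[_ mu0 mu_sup]].
  have t_nat : Sigma_natural t by move=> A C f; exact: (t_lax _ _ f).2.
  rewrite -mut; split; [exact: set_function_of_le|exact: Sigma_natural_set0|].
  move=> E En En_triv EU.
  have /lefP/(_ tt) := (t_lax _ _ (pmap_total nat_cset)).1
    (nat_family En_triv EU).
  rewrite F_total nonneg_leE => le_t; apply: le_trans le_t.
  by rewrite G_total Sigma_natural_tau.
move=> A C f; split=> [E|f_Sigma]; last exact: (tau_Sigma_natural mu0 tE).
apply/lefP => c; have [En [En_triv EU Esum]] := fiber_sequence f E c mu0.
rewrite nonneg_leE !tE; apply: le_trans _ (mu_sup _ _ En_triv EU).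
by rewrite -Esum.
Qed.

Lemma strict_transfP t : strict_transf (F_B B) (G_R R) t <->
  lax_transf (F_B B) (G_R R) Sigma t /\ colax_transf (F_B B) (G_R R) Sigma t.
Proof.
split=> [t_strict|[t_lax t_colax] A C f E].
  by split=> A C f; split=> // E; rewrite t_strict.
by apply/eqP; rewrite eq_le (t_lax _ _ f).1 (t_colax _ _ f).1.
Qed.

(** Additivity for the decomposition of [E'] into [E] and the difference of [E'] and [E], which lies
    in the algebra. *)
Lemma premeasure_le mu : premeasure R B mu ->
  {homo mu : E E' / (E <= E')%O}.
Proof.
move=> [mu0 mu_add] E E' /subsetPset EE'.
have DE : \val E' `\` \val E \in members B.
  by apply/mem_set/alg_setD; [exact: set_mem (valP E')|exact: set_mem (valP E)].
(* Empty sets from index 2 on make a sequence of the two pieces, in the shape of [bigcup2]. *)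
pose En n : B :=
  if n is n'.+1 then if n' is _.+1 then empty_member B else SigSub DE else E.
have EnE : (fun n => \val (En n)) = bigcup2 (\val E) (\val E' `\` \val E).
  by apply/funext => -[|[|n]].
have En_triv : trivIset setT (fun n => \val (En n)).
  by rewrite EnE -trivIset_bigcup2 setDIK.
have EU : \val E' = \bigcup_n \val (En n).
  by rewrite EnE bigcup2E setDUK.
rewrite nonneg_leE (mu_add _ _ En_triv EU).
(* [mu E] is the partial sum of length 1 of a series with nonnegative terms. *)
apply: le_trans (nneseries_lim_ge 1 _) => //.
by rewrite big_nat1.
Qed.

Lemma premeasureP mu : premeasure R B mu <->
  outer_premeasure R B mu /\ inner_premeasure R B mu.
Proof.
split=> [mu_pre|[[_ mu0 mu_sub] [_ _ mu_sup]]].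
  have [mu0 mu_add] := mu_pre; have mu_le := premeasure_le mu_pre.
  by split; split=> // E En En_triv EU; rewrite (mu_add _ _ En_triv EU).
split=> // E En En_triv EU; apply/eqP.
by rewrite eq_le (mu_sub _ _ En_triv EU) (mu_sup _ _ En_triv EU).
Qed.

Lemma strict_tauP mu (t : transf (F_B B) (G_R R)) :
  (forall A E, t A E = tau mu E) ->
  strict_transf (F_B B) (G_R R) t <-> premeasure R B mu.
Proof.
move=> tE; have laxP := lax_tauP tE; have colaxP := colax_tauP tE.
split=> [/strict_transfP[/laxP ? /colaxP ?]|/premeasureP[/laxP ? /colaxP ?]].
  exact/premeasureP.
exact/strict_transfP.
Qed.

(** * The isomorphisms of posets *)

(** Common to the three cases: the first hypothesis allows [tau_transf] to be formed, the second
    recovers [t] from its set function, and the third matches [M] with [T]. *)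
Lemma tau_poset_iso (M : set (B -> {nonneg \bar R}))
    (T : set (transf (F_B B) (G_R R))) :
  (forall mu, M mu -> {homo mu : E E' / (E <= E')%O}) ->
  (forall t, T t -> Sigma_natural t) ->
  (forall mu (t : transf (F_B B) (G_R R)),
    (forall A E, t A E = tau mu E) -> T t <-> M mu) ->
  exists Phi : M -> T,
    (forall (mu : M) A E, \val (Phi mu) A E = tau (\val mu) E) /\
    poset_iso Phi.
Proof.
move=> M_le T_nat TM.
have M_mono (mu : M) : {homo \val mu : E E' / (E <= E')%O}.
  exact: M_le (set_mem (valP mu)).
have M_T (mu : M) : tau_transf (M_mono mu) \in T.
  by apply/mem_set/(TM (\val mu)) => //; exact: set_mem (valP mu).
have T_M (t : T) : set_function_of (\val t) \in M.
  apply/mem_set/(TM _ (\val t)); last exact: set_mem (valP t).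
  by apply: Sigma_natural_tau; apply: T_nat; exact: set_mem (valP t).
exists (fun mu : M => SigSub (M_T mu)); split=> //; split.
  exists (fun t : T => SigSub (T_M t)) => [mu|t]; apply/val_inj => /=.
    exact: set_function_of_tau.
  apply: transf_ext => A E; rewrite [RHS]Sigma_natural_tau//.
  by apply: T_nat; exact: set_mem (valP t).
(* One-point families detect the order, their only component under [tau mu] being [mu E]; conversely
   the order on transformations is componentwise. *)
move=> mu nu; apply/idP/idP => [/asboolP le_t|/lefP le_mu].
  apply/lefP => E; have /lefP/(_ tt) := le_t unit_cset (single_family E).
  exact.
by apply/asboolP => A E; apply/lefP => a; exact: le_mu.
Qed.

End transformations_of_set_functions.

Theorem theorem6p7 (R : realType) (X : Type) (B : set_algebra X) :
  [/\ exists Phi : outer_premeasure R B ->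
                   lax_transf (F_B B) (G_R R) Sigma,
        (forall mu A E, \val (Phi mu) A E = tau (\val mu) E) /\
        poset_iso Phi,
      exists Phi : premeasure R B ->
                   strict_transf (F_B B) (G_R R),
        (forall mu A E, \val (Phi mu) A E = tau (\val mu) E) /\
        poset_iso Phi &
      exists Phi : inner_premeasure R B ->
                   colax_transf (F_B B) (G_R R) Sigma,
        (forall mu A E, \val (Phi mu) A E = tau (\val mu) E) /\
        poset_iso Phi].
Proof.
split; apply: tau_poset_iso.
- by move=> mu [].
- by move=> t t_lax A C f; exact: (t_lax _ _ f).2.
- exact: lax_tauP.
- exact: premeasure_le.
- by move=> t t_strict A C f _; exact: t_strict.
- exact: strict_tauP.
- by move=> mu [].
- by move=> t t_colax A C f; exact: (t_colax _ _ f).2.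
- exact: colax_tauP.
Qed.
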